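(* Let $A\in\overline{\mathbb{R}}^{n\times n}$ and let $\mathbf{x}=(x_1,\dots,x_n)^T\in\mathscr{X}$. Then $\mathbf{x}$ is an extremal in $\mathscr{X}'$ if and only if its tangent digraph $\mathcal{D}_{\mathbf{x}}$ satisfies all of the following conditions: (i) $\mathrm{Supp}(\mathbf{x})$ does not have any nonempty proper subset that is an isolated node set in $\mathcal{D}_{\mathbf{x}}$; (ii) $\mathcal{D}_{\mathbf{x}}$ does not have two different node-disjoint cycles; (iii) there is at most one variable node in $\mathcal{D}_{\mathbf{x}}$.
   Context: Max-plus algebra: $\overline{\mathbb{R}}=\mathbb{R}\cup\{-\infty\}$ with $a\oplus b=\max(a,b)$ and $a\otimes b=a+b$ (where $a+(-\infty)=-\infty$), extended to matrices and vectors as in linear algebra, so $(A\otimes\mathbf{x})_i=\max_{j}(a_{ij}+x_j)$ and $\mathbf{x}\oplus\mathbf{y}$ is the componentwise maximum; $\le$ is componentwise. $N=\{1,\dots,n\}$; $-\infty$ also denotes the vector all of whose components are $-\infty$. For $A\in\overline{\mathbb{R}}^{n\times n}$ put $\mathscr{X}=\{\mathbf{x}\in\overline{\mathbb{R}}^n: A\otimes\mathbf{x}\ge\mathbf{x},\ \mathbf{x}\ne-\infty\}$ and $\mathscr{X}'=\mathscr{X}\cup\{-\infty\}$. $\mathrm{Supp}(\mathbf{x})=\{j\in N: x_j\in\mathbb{R}\}$. A vector $\mathbf{v}\in S\subseteq\overline{\mathbb{R}}^n$ is an extremal in $S$ if for all $\mathbf{y},\mathbf{z}\in S$, $\mathbf{v}=\mathbf{y}\oplus\mathbf{z}$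 implies $\mathbf{v}=\mathbf{y}$ or $\mathbf{v}=\mathbf{z}$. Tangent digraph: for $\mathbf{x}\in\mathscr{X}$ and $i\in\mathrm{Supp}(\mathbf{x})$ let $V_{\mathbf{x}}(i)=\{j\in N: a_{ij}+x_j=\max_{k\in N}(a_{ik}+x_k)=x_i\}$. The tangent digraph $\mathcal{D}_{\mathbf{x}}$ has node set $\mathrm{Supp}(\mathbf{x})$ and arc set $E_{\mathbf{x}}=\{(j,i): i\in\mathrm{Supp}(\mathbf{x}),\ j\in V_{\mathbf{x}}(i)\}$. The arc $(j,i)$ is an outgoing arc of $j$ and an incoming arc of its endnode $i$; a loop $(i,i)$ is both an incoming and an outgoing arc of $i$. Variable nodes: a node $i\in\mathrm{Supp}(\mathbf{x})$ is I-variable if it has no outgoing arc in $\mathcal{D}_{\mathbf{x}}$ other than possibly $(i,i)$; it is II-variable if the endnode of any outgoing arc from $i$ except $(i,i)$ (if it exists) has another incoming arc in $\mathcal{D}_{\mathbf{x}}$. A node is variable if it is I-variable or II-variable. A set $W\subseteq\mathrm{Supp}(\mathbf{x})$ is an isolated node set in $\mathcal{D}_{\mathbf{x}}$ if there is no arc in $\mathcal{D}_{\mathbf{x}}$ from a node of $\mathrm{Supp}(\mathbf{x})\setminus W$ to a node of $W$ and no arc from a node of $W$ to a node of $\mathrm{Supp}(\mathbf{x})\setminus W$. A cycle is a sequence of nodes $(i_1,\dots,i_k)$ with $k\ge2$, $i_1=i_k$ and $(i_t,i_{t+1})$ an arc for all $t=1,\dots,k-1$; loops count as cycles. Two cycles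 are node-disjoint if they have no node in common. *)

(* Defs.v *)
From HB Require Import structures.
From mathcomp Require Import all_boot all_order all_algebra.
From mathcomp Require Import boolp classical_sets reals constructive_ereal.

Set Implicit Arguments.
Unset Strict Implicit.
Unset Printing Implicit Defensive.

Import Order.TTheory GRing.Theory Num.Theory.

Local Open Scope ring_scope.
Local Open Scope ereal_scope.

(* The max-plus semiring R \cup {-oo} is encoded as the part of [\bar R] that
   excludes [+oo]; on that part [maxe] and [+] are the max-plus operations,
   with [-oo + a = a + -oo = -oo]. *)
Definition maxplus_mx (R : realType) (m n : nat) (M : 'M[\bar R]_(m, n)) : Prop :=
  forall i j, M i j <> +oo.

Definition mp_add (R : realType) (m n : nat) (M P : 'M[\bar R]_(m, n)) :
  'M[\bar R]_(m, n) := map2_mx maxe M P.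

Definition mp_mul (R : realType) (m n p : nat)
    (M : 'M[\bar R]_(m, n)) (P : 'M[\bar R]_(n, p)) : 'M[\bar R]_(m, p) :=
  \matrix_(i, k) \big[maxe/-oo]_(j < n) (M i j + P j k).

Definition mp_le (R : realType) (m n : nat) (M P : 'M[\bar R]_(m, n)) : Prop :=
  forall i j, M i j <= P i j.

Definition mp_ninfty (R : realType) (n : nat) : 'cV[\bar R]_n := const_mx -oo.

Definition supereig (R : realType) (n : nat) (A : 'M[\bar R]_n) :
    set 'cV[\bar R]_n :=
  [set x | [/\ maxplus_mx x, mp_le x (mp_mul A x) & x <> mp_ninfty R n]]%classic.

Definition supereig' (R : realType) (n : nat) (A : 'M[\bar R]_n) :
    set 'cV[\bar R]_n :=
  (supereig A `|` [set mp_ninfty R n])%classic.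

Definition extremal (R : realType) (n : nat) (S : set 'cV[\bar R]_n)
    (v : 'cV[\bar R]_n) : Prop :=
  S v /\ forall y z, S y -> S z -> v = mp_add y z -> v = y \/ v = z.

Definition supp (R : realType) (n : nat) (x : 'cV[\bar R]_n) : {set 'I_n} :=
  [set j | x j ord0 \is a fin_num]%SET.

Definition tangentV (R : realType) (n : nat) (A : 'M[\bar R]_n)
    (x : 'cV[\bar R]_n) (i : 'I_n) : {set 'I_n} :=
  [set j | (A i j + x j ord0 == mp_mul A x i ord0)
           && (mp_mul A x i ord0 == x i ord0)]%SET.

(* [tangent_arc A x j i]: (j, i) is an arc, from j to i.  If x has no [+oo]
   entry and i is in its support, then so is every j in [tangentV A x i]. *)
Definition tangent_arc (R : realType) (n : nat) (A : 'M[\bar R]_n)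
    (x : 'cV[\bar R]_n) : rel 'I_n :=
  fun j i => (i \in supp x) && (j \in tangentV A x i).

Definition I_variable (R : realType) (n : nat) (A : 'M[\bar R]_n)
    (x : 'cV[\bar R]_n) (i : 'I_n) : Prop :=
  i \in supp x /\ forall k, tangent_arc A x i k -> k = i.

(* The other incoming arc of k may be the loop (k, k). *)
Definition II_variable (R : realType) (n : nat) (A : 'M[\bar R]_n)
    (x : 'cV[\bar R]_n) (i : 'I_n) : Prop :=
  i \in supp x /\
  forall k, tangent_arc A x i k -> k <> i ->
    exists j, j <> i /\ tangent_arc A x j k.

Definition variable_node (R : realType) (n : nat) (A : 'M[\bar R]_n)
    (x : 'cV[\bar R]_n) (i : 'I_n) : Prop :=
  I_variable A x i \/ II_variable A x i.

Definition isolated (R : realType) (n : nat) (A : 'M[\bar R]_n)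
    (x : 'cV[\bar R]_n) (W : {set 'I_n}) : Prop :=
  W \subset supp x /\
  forall u w, u \in (supp x :\: W)%SET -> w \in W ->
    ~ tangent_arc A x u w /\ ~ tangent_arc A x w u.

(* A cycle is given with its first node repeated at the end, so a loop at i is
   [:: i; i]; intermediate repetitions are allowed. *)
Definition is_cycle (n : nat) (e : rel 'I_n) (c : seq 'I_n) : bool :=
  if c is i :: p then [&& p != [::], path e i p & last i p == i] else false.

Definition node_disjoint (n : nat) (c1 c2 : seq 'I_n) : Prop :=
  forall i, ~ (i \in c1 /\ i \in c2).

(* Main.v *)
(* For a node set D, lowering the entries of x on D by a small amount stays in
   X' exactly when every node outside D that has an incoming arc has one coming
   from outside D ("lowerable" below).  Hence x is extremal iff its support has
   no two disjoint nonempty lowerable subsets, a property of the digraph alone.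

   Variable nodes are the lowerable singletons; an isolated set and its
   complement are both lowerable; and two disjoint cycles yield two lowerable
   sets by following predecessors backwards.  Conversely, a minimal lowerable
   set is a singleton or contains a cycle and receives no arc from outside.  In
   the latter case let C be its complement: either C contains a cycle, or it
   contains a node s without incoming arcs.  Each non-variable node of C is the
   only predecessor of some other node of C, so if at most one node of C is
   variable, then by counting every node of C but s has a single predecessor,
   lying in C, and C is isolated. *)
Require Import Defs.
From HB Require Import structures.
From mathcomp Require Import all_boot all_order all_algebra.
From mathcomp Require Import boolp classical_sets reals constructive_ereal.

Set Implicit Arguments.
Unset Strict Implicit.
Unset Printing Implicit Defensive.

Import Order.TTheory GRing.Theory Num.Theory.

Local Open Scope ring_scope.
Local Open Scope ereal_scope.

(** * Lowerable sets and cycles in a finite digraph *)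

(** A node without predecessors is exempt: in the tangent digraph it is off the support or its
    inequality is strict, so it tolerates a small decrease elsewhere. *)
Definition lowerable (n : nat) (e : rel 'I_n) (D : {set 'I_n}) : bool :=
  [forall k, (k \notin D) ==> [exists j, e j k] ==>
             [exists j, e j k && (j \notin D)]].

Lemma lowerableP {n : nat} {e : rel 'I_n} {D : {set 'I_n}} :
  reflect (forall i k, k \notin D -> e i k -> exists2 j, e j k & j \notin D)
          (lowerable e D).
Proof.
apply: (iffP forallP) => [lowD i k kD eik|lowD k].
  have pred_k : [exists j, e j k] by apply/existsP; exists i.
  have := lowD k; rewrite kD pred_k => /existsP[j /andP[ejk jD]].
  by exists j.
apply/implyP => kD; apply/implyP => /existsP[i eik].
by have [j ejk jD] := lowD i k kD eik; apply/existsP; exists j; rewrite ejk.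
Qed.

Lemma lowerable_variable (R : realType) (n : nat) (A : 'M[\bar R]_n)
    (x : 'cV[\bar R]_n) (i : 'I_n) :
  variable_node A x i <->
  i \in supp x /\ lowerable (tangent_arc A x) [set i]%SET.
Proof.
split=> [var_i|[iS /lowerableP low_i]].
  (* An I-variable node is vacuously II-variable, so one kind suffices. *)
  have {var_i}[iS var_i] : II_variable A x i.
    by case: var_i => // -[iS out_i]; split=> // k /out_i.
  split=> //; apply/lowerableP => j k; rewrite finset.in_set1 => /eqP ki ejk.
  have [ji|/eqP ji] := eqVneq j i.
    rewrite ji in ejk; have [l [/eqP li elk]] := var_i k ejk ki.
    by exists l; rewrite // finset.in_set1.
  by exists j => //; rewrite finset.in_set1; apply/eqP.
right; split=> // k eik /eqP ki.
have [|j ejk] := low_i i k _ eik; rewrite finset.in_set1 // => /eqP ji.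
by exists j.
Qed.

Lemma is_cycle_pred (n : nat) (e : rel 'I_n) (c : seq 'I_n) (i : 'I_n) :
  is_cycle e c -> i \in c -> exists2 j, j \in c & e j i.
Proof.
case: c => // u p /and3P[p0 eup /eqP lup].
have up : u \in p by case: p p0 {eup} lup => //= v p _ <-; rewrite mem_last.
rewrite inE => /predU1P ip.
have {}ip : i \in p by case: ip => [->|].
have cyc : cycle e p by rewrite (cycle_path u) lup.
by exists (prev p i); [rewrite inE mem_prev ip orbT | apply: prev_cycle].
Qed.

(** Iterating a choice of predecessor inside the finite set [D] must eventually repeat; the loop,
    read backwards, is a cycle. *)
Lemma cycle_in_pred_closed (n : nat) (e : rel 'I_n) (D : {set 'I_n}) :
  D != finset.set0 -> (forall i, i \in D -> exists2 j, j \in D & e j i) ->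
  exists2 c, is_cycle e c & {subset c <= D}.
Proof.
move=> /set0Pn[u uD] predD.
pose f i := odflt i [pick j in D | e j i].
have fP i : i \in D -> f i \in D /\ e (f i) i.
  move=> iD; rewrite /f; case: pickP => [j /andP[]//|noj].
  by have [j jD eji] := predD i iD; have := noj j; rewrite jD eji.
have iter_in k v : v \in D -> iter k f v \in D.
  by move=> vD; elim: k => //= k /fP[].
have /trajectP[k ltk itk] := looping_order f u.
set v := iter k f u in itk.
have vD : v \in D by apply: iter_in.
(* [order f u - k] steps lead from [v] back to [v]; one less is taken because the walk starts at
   [f v]. *)
pose m := (order f u - k).-1.
have itm : iter m f (f v) = v.
  by rewrite -iterSr prednK ?subn_gt0// -iterD ?subnK// ltnW.
have pathf w q : w \in D -> path (fun y => e^~ y) w (traject f (f w) q).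
  by elim: q w => //= q IHq w wD; have [fwD ->] := fP w wD; apply: IHq.
pose p := traject f (f v) m.+1.
have lastp : last v p = v by rewrite last_traject iterSr.
exists (v :: rev (belast v p)).
  apply/and3P; split.
  - by rewrite -size_eq0 size_rev size_belast size_traject.
  - by rewrite -[X in path _ X _]lastp rev_path; apply: pathf.
  - by rewrite /p /= rev_cons last_rcons.
move=> w; rewrite inE => /predU1P[->//|]; rewrite mem_rev => /mem_belast.
rewrite inE => /predU1P[->//|/trajectP[q _ ->]].
by rewrite -iterSr; apply: iter_in.
Qed.

(** In a minimal [D'] other than a singleton, removing [i] destroys lowerability, and this can only
    happen at [i]: so [i] has predecessors, all of them in [D']. *)
Lemma minimal_lowerable (n : nat) (e : rel 'I_n) (D : {set 'I_n}) :
  lowerable e D -> D != finset.set0 ->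
  exists D' : {set 'I_n},
    [/\ D' \subset D, D' != finset.set0, lowerable e D' &
        (exists i, D' = [set i]%SET) \/
        (forall i, i \in D' ->
           (exists j, e j i) /\ (forall j, e j i -> j \in D'))].
Proof.
move=> lowD D0.
pose P := [pred B : {set 'I_n} | lowerable e B & B != finset.set0].
have PD : P D by apply/andP.
have [D' /minsetP[/andP[lowD' D'0] minD'] subD'] := minset_exists PD.
exists D'; split=> //.
have [|] := boolP [exists i, D' == [set i]%SET].
  by move=> /existsP[i /eqP]; left; exists i.
rewrite negb_exists => /forallP D'1; right=> i iD'.
have /negP nlow : ~~ lowerable e (D' :\ i).
  apply/negP => low; have : D' :\ i = D'.
    apply: minD'; last exact: finset.subD1set.
    apply/andP; split=> //; apply/negP => /eqP D'i.
    by have := finset.setD1K iD'; rewrite D'i finset.setU0 => /esym/eqP; apply/negP.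
  by move=> D'i; move: iD'; rewrite -D'i !inE eqxx.
have predD' j : e j i -> j \in D'.
  move=> eji; apply: contrapT => /negP jD'; apply: nlow.
  apply/lowerableP => l k kD elk.
  have [ki|ki] := eqVneq k i.
    by exists j; rewrite ?ki// !inE negb_and jD' orbT.
  have kD' : k \notin D' by move: kD; rewrite !inE ki.
  have [h ehk hD'] := lowerableP lowD' l k kD' elk.
  by exists h; rewrite // !inE negb_and hD' orbT.
split=> //; apply: contrapT => noj; apply: nlow.
apply/lowerableP => l k kD elk.
have [ki|ki] := eqVneq k i; first by case: noj; exists l; rewrite -ki.
have kD' : k \notin D' by move: kD; rewrite !inE ki.
have [h ehk hD'] := lowerableP lowD' l k kD' elk.
by exists h; rewrite // !inE negb_and hD' orbT.
Qed.

(** * Digraph obstructions from disjoint lowerable sets *)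

(** The failure of one of the three conditions, for an abstract digraph on [S]; variable nodes enter
    as lowerable singletons. *)
Definition obstruction (n : nat) (e : rel 'I_n) (S : {set 'I_n}) : Prop :=
  [\/ exists W : {set 'I_n}, [/\ W != finset.set0, W \proper S &
        forall u w, u \in S :\: W -> w \in W -> ~ e u w /\ ~ e w u],
      exists c1 c2, [/\ is_cycle e c1, is_cycle e c2 & node_disjoint c1 c2] |
      exists i j, [/\ i \in S, j \in S, i <> j, lowerable e [set i]%SET &
                      lowerable e [set j]%SET]].

Lemma pred_closed_obstruction (n : nat) (e : rel 'I_n) (S D : {set 'I_n}) :
  (forall j i, e j i -> j \in S /\ i \in S) ->
  D != finset.set0 -> D \proper S -> lowerable e D ->
  (forall i, i \in D -> (exists j, e j i) /\ (forall j, e j i -> j \in D)) ->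
  obstruction e S.
Proof.
move=> eS D0 /properP[subDS [c cS cD]] /lowerableP lowD predD.
pose C := S :\: D.
have C0 : C != finset.set0 by apply/set0Pn; exists c; rewrite inE cD.
have [/existsP[s /andP[sC /forallP nopred]]|] :=
    boolP [exists s in C, [forall j, ~~ e j s]]; last first.
  (* Each node of [C] has a predecessor, hence one in [C] as [D] is lowerable; so [D] and [C] both
     contain cycles. *)
  rewrite negb_exists => /forallP allpred; constructor 2.
  have [|c1 cyc1 c1D] := @cycle_in_pred_closed n e D D0.
    by move=> i /predD[[j eji] predi]; exists j => //; apply: predi.
  have [i iC|c2 cyc2 c2C] := @cycle_in_pred_closed n e C C0.
    have := allpred i; rewrite iC negb_forall => /existsP[j]; rewrite negbK.
    have iD : i \notin D by move: iC; rewrite inE => /andP[].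
    move=> /(lowD _ _ iD)[h ehi hD].
    by exists h => //; rewrite inE hD; have [] := eS _ _ ehi.
  exists c1, c2; split=> // i [/c1D iD /c2C].
  by rewrite inE iD.
pose V := [set j in C | lowerable e [set j]%SET]%SET.
have [/existsP[i /existsP[j /and3P[]]]|/existsPn V1] :=
    boolP [exists i, exists j, [&& i \in V, j \in V & i != j]].
  rewrite !inE -!andbA => /and3P[_ iS lowi] /and3P[_ jS lowj] /eqP ij.
  by constructor 3; exists i, j.
constructor 1; exists C; split=> //.
  apply/properP; split; first exact: subsetDl.
  have /set0Pn[u uD] := D0.
  by exists u; [apply: (fintype.subsetP subDS) | rewrite inE uD].
(* The map [g] sends a non-variable node to a node of which it is the only
   predecessor; counting, it covers every node of [C] but the source [s]. *)
pose g j := odflt j [pick k | e j k && [forall i, e i k ==> (i == j)]].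
have gP j : j \in C :\: V ->
    e j (g j) /\ forall i, e i (g j) -> i = j.
  rewrite inE => /andP[jV jC]; rewrite /g.
  case: pickP => [k /andP[ejk /forallP only]|nok].
    by split=> // i eik; apply/eqP; apply: (implyP (only i)).
  (* With no such [k], every successor of [j] has a second predecessor, which makes the singleton of
     [j] lowerable. *)
  exfalso; move: jV; rewrite inE jC => /negP; apply.
  apply/lowerableP => i k; rewrite finset.in_set1 => kj eik.
  have [ij|ij] := eqVneq i j; last by exists i; rewrite ?finset.in_set1.
  have := nok k; rewrite -{1}ij eik /= => /negbT; rewrite negb_forall.
  by move=> /existsP[h]; rewrite negb_imply => /andP[]; exists h;
     rewrite ?finset.in_set1.
have cardV : (#|V| <= 1)%N.
  apply/card_le1_eqP => i j iV jV; apply/eqP; apply: contraT => ij.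
  by have /existsPn/(_ j) := V1 i; rewrite iV jV eq_sym ij.
have subgC : g @: (C :\: V) \subset C :\ s.
  apply/fintype.subsetP => _ /imsetP[j jCV ->].
  have [ejg _] := gP j jCV.
  have jC : j \in C by move: jCV; rewrite inE => /andP[].
  rewrite !inE; apply/and3P; split.
  - by apply: contraTneq ejg => ->; apply: nopred.
  - apply/negP => /predD[_ /(_ _ ejg) jD].
    by move: jC; rewrite inE jD.
  - by have [] := eS _ _ ejg.
(* [j] is recovered from [g j] as its only predecessor, so the image has [#|C| - #|V|] elements, at
   least as many as [C :\ s]. *)
have gC : g @: (C :\: V) = C :\ s.
  apply/eqP; rewrite eqEcard subgC card_in_imset; last first.
    move=> i j iCV jCV gij; have [eig _] := gP i iCV.
    by have [_] := gP j jCV; apply; rewrite -gij.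
  have VC : V \subset C by apply/fintype.subsetP => i; rewrite !inE => /andP[].
  rewrite [leqRHS](cardsDS VC).
  by rewrite (leq_trans _ (leq_sub2l _ cardV))// (cardsD1 s C) sC addKn.
move=> u w; rewrite inE => /andP[uC uS] wC.
have uD : u \in D by move: uC; rewrite inE uS andbT negbK.
have wD : w \notin D by move: wC; rewrite inE => /andP[].
split; last by move=> ewu; have [_ /(_ _ ewu)] := predD u uD; apply/negP.
move=> euw; have ws : w != s by apply: contraTneq euw => ->; apply: nopred.
have : w \in C :\ s by rewrite finset.in_setD1 ws.
rewrite -gC => /imsetP[j jCV wg]; have [_ /(_ u)] := gP j jCV.
rewrite -wg => /(_ euw) uj; move: jCV; rewrite -uj inE => /andP[_].
by rewrite inE uD.
Qed.

(** Once both sets are shrunk to minimal ones, either both are singletons, or one is closed under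
    predecessors, and proper in [S] because it misses the other. *)
Lemma disjoint_lowerable_obstruction (n : nat) (e : rel 'I_n)
    (S D1 D2 : {set 'I_n}) :
  (forall j i, e j i -> j \in S /\ i \in S) ->
  D1 \subset S -> D2 \subset S -> D1 != finset.set0 -> D2 != finset.set0 ->
  [disjoint D1 & D2] -> lowerable e D1 -> lowerable e D2 ->
  obstruction e S.
Proof.
move=> eS D1S D2S D10 D20 dis low1 low2.
have [E1 [sub1 E10 lowE1 min1]] := minimal_lowerable low1 D10.
have [E2 [sub2 E20 lowE2 min2]] := minimal_lowerable low2 D20.
have {}dis : [disjoint E1 & E2] by apply: disjointW dis.
have {}D1S := fintype.subset_trans sub1 D1S.
have {}D2S := fintype.subset_trans sub2 D2S.
case: min1 => [[i Ei]|min1]; last first.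
  apply: pred_closed_obstruction E10 _ lowE1 min1 => //.
  apply/properP; split=> //; have /set0Pn[u uE2] := E20.
  exists u; first exact: (fintype.subsetP D2S).
  by rewrite (disjointFl dis).
case: min2 => [[j Ej]|min2]; last first.
  apply: pred_closed_obstruction E20 _ lowE2 min2 => //.
  apply/properP; split=> //; have /set0Pn[u uE1] := E10.
  exists u; first exact: (fintype.subsetP D1S).
  by rewrite (disjointFr dis).
constructor 3; exists i, j; rewrite -Ei -Ej; split=> //.
- by apply: (fintype.subsetP D1S); rewrite Ei finset.set11.
- by apply: (fintype.subsetP D2S); rewrite Ej finset.set11.
- by move=> ij; move: dis; rewrite Ei Ej ij disjoints1 finset.set11.
Qed.

(* Following one chosen predecessor of each node, taken inside the cycle for
   the nodes of a cycle, a backward walk cannot enter two disjoint cycles. *)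
Lemma disjoint_cycles_lowerable (n : nat) (e : rel 'I_n) (c1 c2 : seq 'I_n) :
  is_cycle e c1 -> is_cycle e c2 -> node_disjoint c1 c2 ->
  exists D1 D2 : {set 'I_n},
    [/\ {subset c1 <= D1}, {subset c2 <= D2}, [disjoint D1 & D2],
        lowerable e D1 & lowerable e D2].
Proof.
move=> cyc1 cyc2 dis.
pose r i j := e j i && ((i \in c1) ==> (j \in c1)) && ((i \in c2) ==> (j \in c2)).
pose f i := odflt i [pick j | r i j].
have fP i j : e j i -> r i (f i).
  move=> eji; rewrite /f; case: pickP => // nor.
  have [ic1|ic1] := boolP (i \in c1).
    have [h hc1 ehi] := is_cycle_pred cyc1 ic1; have := nor h.
    have /negPf ic2 : i \notin c2 by apply/negP => ic2; apply: (dis i).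
    by rewrite /r ehi hc1 ic2 implybT.
  have [ic2|ic2] := boolP (i \in c2).
    have [h hc2 ehi] := is_cycle_pred cyc2 ic2; have := nor h.
    by rewrite /r ehi hc2 (negPf ic1) implybT.
  by have := nor j; rewrite /r eji (negPf ic1) (negPf ic2).
have stay c k i : (c = c1) \/ (c = c2) -> i \in c -> iter k f i \in c.
  move=> cc ic; elim: k => //= k IHk.
  have [j _ ej] : exists2 j, j \in c & e j (iter k f i).
    by apply: is_cycle_pred IHk; case: cc => ->.
  have /andP[/andP[_ /implyP r1] /implyP r2] := fP _ _ ej.
  by case: cc IHk => ->.
pose D (c : seq 'I_n) := [set i | [exists j in c, fconnect f i j]]%SET.
have DP c i : reflect (exists k, iter k f i \in c) (i \in D c).
  rewrite inE; apply: (iffP existsP) => [[j /andP[jc /iter_findex ij]]|[k ic]].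
    by exists (findex f i j); rewrite ij.
  by exists (iter k f i); rewrite ic fconnect_iter.
have lowD c : lowerable e (D c).
  apply/lowerableP => i k kD eik; exists (f k).
    by have /andP[/andP[]] := fP _ _ eik.
  by apply: contra kD => /DP[m mc]; apply/DP; exists m.+1; rewrite iterSr.
have subD c : {subset c <= D c} by move=> i ic; apply/DP; exists 0%N.
exists (D c1), (D c2); split=> //.
apply/pred0P => i; apply/negP => /andP[/DP[k1 i1] /DP[k2 i2]].
(* After [k1 + k2] steps the walk from [i] has entered both cycles and, by [stay], is still in
   both. *)
apply: (dis (iter (k1 + k2) f i)); split.
  by rewrite addnC iterD; apply: stay => //; left.
by rewrite iterD; apply: stay => //; right.
Qed.

(** * Lowering a vector along its tangent digraph *)

Lemma tangent_arc_supp (R : realType) (n : nat) (A : 'M[\bar R]_n)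
    (x : 'cV[\bar R]_n) (j i : 'I_n) :
  tangent_arc A x j i -> j \in supp x /\ i \in supp x.
Proof.
rewrite /tangent_arc !inE => /andP[iS /andP[/eqP Aij /eqP xi]]; split=> //.
by move: iS; rewrite -xi -Aij fin_numD => /andP[].
Qed.

Lemma mp_mul_ge (R : realType) (n : nat) (A : 'M[\bar R]_n)
    (x : 'cV[\bar R]_n) (i j : 'I_n) :
  A i j + x j ord0 <= mp_mul A x i ord0.
Proof. by rewrite mxE (le_bigmax _ (fun j => A i j + x j ord0)). Qed.

Lemma mp_mul_attained (R : realType) (n : nat) (A : 'M[\bar R]_n)
    (x : 'cV[\bar R]_n) (i : 'I_n) :
  exists j, mp_mul A x i ord0 = A i j + x j ord0.
Proof.
rewrite mxE.
have [//|j _|j _ ->] := @eq_bigmax _ _ _ -oo i xpredT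
  (fun j => A i j + x j ord0); [exact: leNye | by exists j].
Qed.

Definition lower (R : realType) (n : nat) (x : 'cV[\bar R]_n)
    (D : {set 'I_n}) (eps : R) : 'cV[\bar R]_n :=
  \col_i (if i \in D then x i ord0 - eps%:E else x i ord0).

(** Lowering decreases [mp_mul A x] by at most [eps], which settles the rows in [D]. Outside [D], a
    tight row keeps its value through an arc from outside [D], and a strict row has slack at least
    [eps]. *)
Lemma lower_supereig' (R : realType) (n : nat) (A : 'M[\bar R]_n)
    (x : 'cV[\bar R]_n) (D : {set 'I_n}) :
  maxplus_mx A -> supereig A x -> lowerable (tangent_arc A x) D ->
  exists2 eps : R, (0 < eps)%R & supereig' A (lower x D eps).
Proof.
move=> hA [xoo xle x0] /lowerableP lowD.
pose slack k := (fine (mp_mul A x k ord0) - fine (x k ord0))%R.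
(* The default 1 keeps [eps] positive if no slack is; infinite entries, which [fine] reads as 0, can
   only make it smaller. *)
pose eps := (\big[Num.min/1%R]_(k | (0 < slack k)%R) slack k)%R.
have eps0 : (0 < eps)%R by apply/bigmin_gtP; split.
exists eps => //; set y := lower x D eps.
have yin j : j \in D -> y j ord0 = x j ord0 - eps%:E by rewrite mxE => ->.
have yout j : j \notin D -> y j ord0 = x j ord0.
  by rewrite mxE => /negPf ->.
have ylb j : x j ord0 - eps%:E <= y j ord0.
  have [jD|jD] := boolP (j \in D); first by rewrite yin.
  by rewrite yout// geeDl// -EFinN lee_fin oppr_le0 ltW.
have mul_lower k : mp_mul A x k ord0 - eps%:E <= mp_mul A y k ord0.
  have [j ->] := mp_mul_attained A x k.
  by apply: le_trans (mp_mul_ge A y k j); rewrite -addeA leeD2l.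
suff yle : mp_le y (mp_mul A y).
  have [->|yN] := pselect (y = mp_ninfty R n); [by right|left; split=> //].
  move=> i j; rewrite (ord1 j).
  have := xoo i ord0; have [iD|iD] := boolP (i \in D); last by rewrite yout.
  by rewrite yin//; case: (x i ord0).
move=> k j; rewrite (ord1 j) {j}.
have xk := xle k ord0.
have [kD|kD] := boolP (k \in D).
  by rewrite yin//; apply: le_trans (mul_lower k); rewrite leeD2r.
rewrite yout//.
have [->|xkN] := eqVneq (x k ord0) -oo; first exact: leNye.
have xkfin : x k ord0 \is a fin_num.
  by rewrite fin_numE xkN; apply/eqP.
have [j mulk] := mp_mul_attained A x k.
have mulfin : mp_mul A x k ord0 \is a fin_num.
  rewrite fin_numE; apply/andP; split.
    by apply: contraNneq xkN => mulN; rewrite -leeNy_eq -mulN.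
  by rewrite mulk -ltey lte_add_pinfty// ltey; apply/eqP.
have [tight|strict] := eqVneq (mp_mul A x k ord0) (x k ord0).
  have arc_jk : tangent_arc A x j k.
    by rewrite /tangent_arc !inE xkfin tight -mulk tight eqxx.
  have [h arc_hk hD] := lowD j k kD arc_jk.
  have : h \in tangentV A x k by case/andP: arc_hk.
  rewrite inE => /andP[/eqP hk _]; rewrite -tight -hk -(yout h)//.
  exact: mp_mul_ge.
apply: le_trans (mul_lower k); rewrite leeBrDr//.
have lek : (eps <= slack k)%R.
  apply: (@bigmin_inf _ _ _ _ k) => //; rewrite subr_gt0.
  by rewrite -lte_fin !fineK// lt_neqAle eq_sym strict.
rewrite -(fineK xkfin) -(fineK mulfin) -EFinD lee_fin -lerBrDl.
exact: lek.
Qed.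

Lemma lower_neq (R : realType) (n : nat) (x : 'cV[\bar R]_n)
    (D : {set 'I_n}) (eps : R) (i : 'I_n) :
  (0 < eps)%R -> i \in D -> i \in supp x -> x <> lower x D eps.
Proof.
move=> eps0 iD; rewrite inE => iS /matrixP/(_ i ord0); rewrite mxE iD.
rewrite -(fineK iS) -EFinB => -[] /eqP.
by rewrite -subr_eq0 opprB addrCA subrr addr0 gt_eqF.
Qed.

Lemma lower_disjoint_add (R : realType) (n : nat) (x : 'cV[\bar R]_n)
    (D1 D2 : {set 'I_n}) (eps1 eps2 : R) :
  (0 < eps1)%R -> (0 < eps2)%R -> [disjoint D1 & D2] ->
  x = mp_add (lower x D1 eps1) (lower x D2 eps2).
Proof.
move=> eps10 eps20 dis; apply/matrixP => i j; rewrite (ord1 j) !mxE.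
have le_low (eps : R) : (0 < eps)%R -> x i ord0 - eps%:E <= x i ord0.
  by move=> /ltW eps0; rewrite geeDl// -EFinN lee_fin oppr_le0.
have [iD1|iD1] := boolP (i \in D1).
  by rewrite (disjointFr dis iD1); apply/esym/max_idPr/le_low.
case: ifP => _; first by apply/esym/max_idPl/le_low.
by rewrite maxxx.
Qed.

Lemma extremal_lowerable (R : realType) (n : nat) (A : 'M[\bar R]_n)
    (x : 'cV[\bar R]_n) (D1 D2 : {set 'I_n}) (i1 i2 : 'I_n) :
  maxplus_mx A -> supereig A x -> extremal (supereig' A) x ->
  lowerable (tangent_arc A x) D1 -> lowerable (tangent_arc A x) D2 ->
  i1 \in D1 -> i2 \in D2 -> i1 \in supp x -> i2 \in supp x ->
  ~ [disjoint D1 & D2].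
Proof.
move=> hA hx [_ ext] low1 low2 iD1 iD2 iS1 iS2 dis.
have [eps1 eps10 X1] := lower_supereig' hA hx low1.
have [eps2 eps20 X2] := lower_supereig' hA hx low2.
have [] := ext _ _ X1 X2 (lower_disjoint_add x eps10 eps20 dis).
  exact: lower_neq iD1 iS1.
exact: lower_neq iD2 iS2.
Qed.

(** If [y] agrees with [x] at the endnode [k] of an arc and [j] attains row [k] of [mp_mul A y],
    then [x k <= A k j + y j <= A k j + x j <= x k]. Cancelling the finite [A k j], [y] agrees with
    [x] at [j], and [(j, k)] is an arc. *)
Lemma neq_lowerable (R : realType) (n : nat) (A : 'M[\bar R]_n)
    (x y : 'cV[\bar R]_n) :
  mp_le y x -> mp_le y (mp_mul A y) ->
  lowerable (tangent_arc A x) [set i in supp x | y i ord0 != x i ord0]%SET.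
Proof.
move=> yx yle; apply/lowerableP => i k kD arc_ik.
have kS : k \in supp x by case/andP: arc_ik.
have yk : y k ord0 = x k ord0.
  by move: kD; rewrite inE kS /= negbK => /eqP.
have tight : mp_mul A x k ord0 = x k ord0.
  by case/andP: arc_ik => _; rewrite inE => /andP[_ /eqP].
have [j mulk] := mp_mul_attained A y k.
have Ajk : A k j + x j ord0 = x k ord0.
  apply/le_anti/andP; split; first by rewrite -[leRHS]tight mp_mul_ge.
  rewrite -[leLHS]yk; apply: le_trans (yle k ord0) _.
  by rewrite mulk leeD2l.
have Ajk' : A k j + y j ord0 = x k ord0.
  apply/le_anti/andP; split; first by rewrite -Ajk leeD2l.
  by rewrite -yk -mulk.
exists j; first by rewrite /tangent_arc kS inE Ajk tight eqxx.
rewrite inE negb_and negbK; apply/orP; right.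
have : A k j + x j ord0 \is a fin_num by rewrite Ajk; move: kS; rewrite inE.
rewrite fin_numD => /andP[Afin _].
apply/eqP/le_anti/andP.
by split; rewrite -(leeD2lE _ _ Afin) Ajk Ajk'.
Qed.

(** Off its support [x] is [-oo], hence so is [y]. *)
Lemma neq_supp (R : realType) (n : nat) (x y : 'cV[\bar R]_n) :
  maxplus_mx x -> mp_le y x -> x <> y ->
  [set i in supp x | y i ord0 != x i ord0]%SET != finset.set0.
Proof.
move=> xoo yx xy; apply/negP => /eqP/setP D0; apply: xy.
apply/matrixP => i j; rewrite (ord1 j).
have := D0 i; rewrite !inE => /negbT; rewrite negb_and negbK.
case/orP => [|/eqP//]; rewrite fin_numE negb_and !negbK.
case/orP => /eqP xi; last by have := xoo i ord0.
by rewrite xi; apply/esym/eqP; rewrite -leeNy_eq -xi.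
Qed.

(** * Extremality and the three conditions *)

Theorem theorem3p1 (R : realType) (n : nat) (A : 'M[\bar R]_n)
    (x : 'cV[\bar R]_n) (hA : maxplus_mx A) (hx : supereig A x) :
  extremal (supereig' A) x <->
  [/\ ~ (exists W : {set 'I_n},
           [/\ W != finset.set0, W \proper supp x & isolated A x W]),
      ~ (exists c1 c2 : seq 'I_n,
           [/\ is_cycle (tangent_arc A x) c1, is_cycle (tangent_arc A x) c2,
               c1 <> c2 & node_disjoint c1 c2])
    & forall i j : 'I_n,
        variable_node A x i -> variable_node A x j -> i = j].
Proof.
have cycle_head c : is_cycle (tangent_arc A x) c ->
    exists2 i, i \in c & i \in supp x.
  case: c => // i p cyc; exists i; first exact: mem_head.
  have [j _ /tangent_arc_supp[]//] := is_cycle_pred cyc (mem_head i p).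
split=> [ext|[noW nocyc var1]].
  split.
  - move=> [W [/set0Pn[i iW] /properP[WS [j jS jW]] [_ iso]]].
    (* No arc joins [W] and [supp x :\: W], so for either set the given predecessor already lies
       outside it. *)
    apply: (@extremal_lowerable _ _ _ _ W (supp x :\: W) i j hA hx ext) => //.
    + apply/lowerableP => h k kW arc_hk; exists h => //; apply/negP => hW.
      have [_ kS] := tangent_arc_supp arc_hk.
      have [|_] := iso k h _ hW; last exact.
      by rewrite inE kW.
    + apply/lowerableP => h k kW arc_hk; exists h => //; apply/negP => hW.
      have [_ kS] := tangent_arc_supp arc_hk.
      have [|+ _] := iso h k hW; last exact.
      by move: kW; rewrite inE kS andbT negbK.
    + by rewrite inE jW.
    + exact: (fintype.subsetP WS).
    + by rewrite disjoint_sym finset.disjoints_subset finset.setDE finset.subsetIr.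
  - move=> [c1 [c2 [cyc1 cyc2 _ dis]]].
    have [D1 [D2 [sub1 sub2 disD low1 low2]]] :=
      disjoint_cycles_lowerable cyc1 cyc2 dis.
    have [i1 ic1 iS1] := cycle_head c1 cyc1.
    have [i2 ic2 iS2] := cycle_head c2 cyc2.
    exact: (extremal_lowerable hA hx ext low1 low2 (sub1 _ ic1) (sub2 _ ic2)).
  - move=> i j /lowerable_variable[iS lowi] /lowerable_variable[jS lowj].
    apply: contrapT => ij.
    apply: (extremal_lowerable hA hx ext lowi lowj _ _ iS jS).
    + exact: finset.set11.
    + exact: finset.set11.
    + by rewrite disjoints1 finset.in_set1; apply/eqP.
split=> [|y z Xy Xz xyz]; first by left.
have X'le v : supereig' A v -> mp_le v (mp_mul A v).
  by case=> [[]//|-> i j]; rewrite mxE leNye.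
have yx : mp_le y x by move=> i j; rewrite xyz mxE le_max lexx.
have zx : mp_le z x by move=> i j; rewrite xyz mxE le_max lexx orbT.
have [xoo _ _] := hx.
apply: contrapT => /not_orP[xy xz].
have subS (v : 'cV[\bar R]_n) :
    [set i in supp x | v i ord0 != x i ord0]%SET \subset supp x.
  by apply/fintype.subsetP => i; rewrite inE => /andP[].
(* Each entry of the maximum [x] is attained by [y] or by [z]. *)
have dis : [disjoint [set i in supp x | y i ord0 != x i ord0]%SET &
                     [set i in supp x | z i ord0 != x i ord0]%SET].
  apply/pred0P => i; apply/negP; rewrite /= !inE.
  move=> /andP[/andP[_ /negP yi] /andP[_ /negP zi]].
  have := congr1 (fun v : 'cV[\bar R]_n => v i ord0) xyz.
  by rewrite mxE; case: leP => _ xi; [apply: zi | apply: yi]; apply/eqP.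
have := disjoint_lowerable_obstruction (@tangent_arc_supp R n A x)
  (subS y) (subS z) (neq_supp xoo yx xy) (neq_supp xoo zx xz) dis
  (neq_lowerable yx (X'le y Xy)) (neq_lowerable zx (X'le z Xz)).
case=> [[W [W0 WS iso]]|[c1 [c2 [cyc1 cyc2 disc]]]|[i [j [iS jS ij lowi lowj]]]].
- by apply: noW; exists W; split=> //; split=> //; exact: proper_sub.
- apply: nocyc; exists c1, c2; split=> // c12.
  by have [i ic1 _] := cycle_head c1 cyc1; apply: (disc i); rewrite -c12.
- by apply: ij; apply: var1; apply/lowerable_variable.
Qed.
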